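(* Let $A$ be a regular ring containing a field of characteristic $p>0$, let $R=A[x_1,\ldots,x_m,y_1,\ldots,y_n]$ be standard bigraded over $A$, and let $M=\bigoplus_{(i,j)\in\mathbb{Z}^2}M_{(i,j)}$ be a bigraded $F_R$-finite $F_R$-module. Then: (1) The following are equivalent: (a) $M_{(a,b)}\neq 0$ for all $(a,b)\geq(0,0)$; (b) there exists $(a_0,b_0)\geq(0,0)$ such that $M_{(a,b)}\neq0$ for all $(a,b)\geq(a_0,b_0)$; (c) $M_{(a_1,b_1)}\neq0$ for some $(a_1,b_1)\geq(0,0)$. (2) The following are equivalent: (a) $M_{(a,b)}\neq0$ for all $(a,b)\in\mathbb{Z}^2$ with $a\leq-m$ and $b\geq0$; (b) there exists $(a_0,b_0)\in\mathbb{Z}^2$ with $a_0\leq-m$ and $b_0\geq0$ such that $M_{(a,b)}\neq0$ for all $(a,b)\in\mathbb{Z}^2$ with $a\leq a_0$ and $b\geq b_0$; (c) $M_{(a_1,b_1)}\neq0$ for some $(a_1,b_1)\in\mathbb{Z}^2$ with $a_1\leq-m$ and $b_1\geq0$. (3) The following are equivalent: (a) $M_{(a,b)}\neq0$ for all $(a,b)\in\mathbb{Z}^2$ with $(a,b)\leq(-m,-n)$; (b) there exists $(a_0,b_0)\in\mathbb{Z}^2$ with $(a_0,b_0)\leq(-m,-n)$ such that $M_{(a,b)}\neq0$ for all $(a,b)\leq(a_0,b_0)$; (c) $M_{(a_1,b_1)}\neq0$ for some $(a_1,b_1)\in\mathbb{Z}^2$ with $(a_1,b_1)\leq(-m,-n)$.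 (4) The following are equivalent: (a) $M_{(a,b)}\neq0$ for all $(a,b)\in\mathbb{Z}^2$ with $a\geq0$ and $b\leq-n$; (b) there exists $(a_0,b_0)\in\mathbb{Z}^2$ with $a_0\geq0$ and $b_0\leq-n$ such that $M_{(a,b)}\neq0$ for all $(a,b)\in\mathbb{Z}^2$ with $a\geq a_0$ and $b\leq b_0$; (c) $M_{(a_1,b_1)}\neq0$ for some $(a_1,b_1)\in\mathbb{Z}^2$ with $a_1\geq0$ and $b_1\leq-n$.
   Context: Rings are commutative and Noetherian; $m,n\geq 1$. Inequalities $\geq,\leq$ between elements of $\mathbb{Z}^2$ are componentwise. Standard bigraded means: elements of $A$ have bidegree $(0,0)$, each $x_i$ has bidegree $(1,0)$, each $y_j$ has bidegree $(0,1)$. For an $R$-module $M$, $F_R(M)={}^{1}R\otimes_R M$, where ${}^{1}R$ is $R$ with its usual left $R$-module structure and right structure $r'\cdot r=r^{p}r'$ (so $a\otimes rm=ar^p\otimes m$). If $M$ is bigraded, $F_R(M)$ is bigraded by $\operatorname{bideg}(r'\otimes m)=\operatorname{bideg}(r')+p\operatorname{bideg}(m)$. An $F_R$-module is an $R$-module $M$ with an $R$-isomorphism $\theta:M\to F_R(M)$; it is bigraded if $M$ is bigraded and $\theta$ preserves bidegree. A generating morphism of $M$ is an injective $R$-linear map $\beta:U\to F_R(U)$ such that $M=\varinjlim(U\xrightarrow{\beta}F_R(U)\xrightarrow{F_R(\beta)}F_R^2(U)\to\cdots)$ with $\theta$ induced by the maps $F_R^e(\beta)$. $M$ is $F_R$-finite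 if it has a generating morphism with $U$ a finitely generated $R$-module; it is a bigraded $F_R$-finite $F_R$-module if in addition $M$ (and $U$) are bigraded and $\beta$ preserves bidegree. *)

(* Defs.v *)
From HB Require Import structures.
From mathcomp Require Import all_boot all_order all_algebra.
From mathcomp Require Import generic_quotient.
From mathcomp Require Import boolp.
From mathcomp Require Import mpoly.

Set Implicit Arguments.
Unset Strict Implicit.
Unset Printing Implicit Defensive.

Import GRing.Theory.
Local Open Scope ring_scope.
Local Open Scope quotient_scope.

Section FiniteGeneration.
Variables (R : comNzRingType) (V : lmodType R).

Definition lin_span (s : seq V) (v : V) : Prop :=
  exists c : nat -> R, v = \sum_(i < size s) c i *: s`_i.

Definition fin_gen : Prop := exists s : seq V, forall v, lin_span s v.

End FiniteGeneration.

Section RegularRings.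

Definition is_ideal (B : comNzRingType) (I : B -> Prop) : Prop :=
  [/\ I 0, forall x y, I x -> I y -> I (x + y) & forall a x, I x -> I (a * x)].

Definition generates (B : comNzRingType) (s : seq B) (I : B -> Prop) : Prop :=
  forall x, I x <-> lin_span (V := B^o) s x.

Definition noetherian (B : comNzRingType) : Prop :=
  forall I : B -> Prop, is_ideal I -> exists s : seq B, generates s I.

Definition is_prime (B : comNzRingType) (P : B -> Prop) : Prop :=
  [/\ is_ideal P, ~ P 1 & forall x y, P (x * y) -> P x \/ P y].

Definition is_maximal (B : comNzRingType) (I : B -> Prop) : Prop :=
  [/\ is_ideal I, ~ I 1 &
      forall J : B -> Prop, is_ideal J -> ~ J 1 ->
        (forall x, I x -> J x) -> forall x, J x -> I x].

Definition prime_chain (B : comNzRingType) (d : nat) : Prop :=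
  exists P : nat -> B -> Prop,
    (forall i, (i <= d)%N -> is_prime (P i)) /\
    (forall i, (i < d)%N ->
       (forall x, P i x -> P i.+1 x) /\ (exists x, P i.+1 x /\ ~ P i x)).

(* Chains can be truncated, so excluding length d + 1 bounds all lengths. *)
Definition krull_dim (B : comNzRingType) (d : nat) : Prop :=
  prime_chain B d /\ ~ prime_chain B d.+1.

Definition regular_local_ring (B : comNzRingType) : Prop :=
  noetherian B /\
  exists mm : B -> Prop,
    [/\ is_maximal mm,
        forall nn : B -> Prop, is_maximal nn -> forall x, nn x <-> mm x &
        exists d, krull_dim B d /\
                  exists s : seq B, size s = d /\ generates s mm].

(* f exhibits B as the localization of A at the prime ideal P; this determines
   B up to a unique isomorphism of A-algebras. *)
Definition is_localization_at (A B : comNzRingType) (P : A -> Prop)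
    (f : {rmorphism A -> B}) : Prop :=
  [/\ forall s, ~ P s -> exists t, f s * t = 1,
      forall b, exists a s, ~ P s /\ f s * b = f a &
      forall a, f a = 0 -> exists s, ~ P s /\ s * a = 0].

Definition regular_ring (A : comNzRingType) : Prop :=
  noetherian A /\
  forall P : A -> Prop, is_prime P ->
    exists (B : comNzRingType) (f : {rmorphism A -> B}),
      is_localization_at P f /\ regular_local_ring B.

End RegularRings.

(* The Frobenius functor.  [frob p M] is the tensor product of the right
   R-module R, with r' . r = r ^+ p * r', and the left R-module M: a word
   [:: (a1, x1); ...; (ak, xk)] stands for the sum of the tensors ai (x) xi, and
   [frob_eq] is the congruence generated by commutativity, biadditivity and
   balancedness.  The case of a zero left factor makes (- a) (x) x an opposite
   of a (x) x, so that the quotient monoid is a group.  The definition makes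
   sense for every p, but the right action above is one only when p is the
   characteristic of R. *)
Section Frobenius.
Variables (p : nat) (R : comNzRingType) (M : lmodType R).

Inductive frob_eq : seq (R * M) -> seq (R * M) -> Prop :=
| frob_eq_refl s : frob_eq s s
| frob_eq_sym s t : frob_eq s t -> frob_eq t s
| frob_eq_trans s t u : frob_eq s t -> frob_eq t u -> frob_eq s u
| frob_eq_cat s s' t t' :
    frob_eq s s' -> frob_eq t t' -> frob_eq (s ++ t) (s' ++ t')
| frob_eq_comm s t : frob_eq (s ++ t) (t ++ s)
| frob_eq_0l x : frob_eq [:: (0, x)] [::]
| frob_eq_Dl a b x : frob_eq [:: (a + b, x)] [:: (a, x); (b, x)]
| frob_eq_Dr a x y : frob_eq [:: (a, x + y)] [:: (a, x); (a, y)]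
| frob_eq_bal a r x : frob_eq [:: (a, r *: x)] [:: (r ^+ p * a, x)].

Definition frob_rel : rel (seq (R * M)) := fun s t => `[< frob_eq s t >].

Lemma frob_rel_refl : reflexive frob_rel.
Proof. by move=> s; apply/asboolP; exact: frob_eq_refl. Qed.

Lemma frob_rel_sym : ssrbool.symmetric frob_rel.
Proof. by move=> s t; apply/asboolP/asboolP; exact: frob_eq_sym. Qed.

Lemma frob_rel_trans : transitive frob_rel.
Proof.
by move=> t s u /asboolP st /asboolP tu; apply/asboolP; exact: frob_eq_trans tu.
Qed.

Canonical frob_equiv :=
  EquivRel frob_rel frob_rel_refl frob_rel_sym frob_rel_trans.

Definition frob := {eq_quot frob_equiv}.
HB.instance Definition _ := Choice.on frob.

Definition frob_word (s : seq (R * M)) : frob := \pi_frob s.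

Lemma frob_wordP s t : frob_word s = frob_word t <-> frob_eq s t.
Proof.
rewrite /frob_word; split=> [/eqP|h]; first by rewrite eqmodE => /asboolP.
by apply/eqP; rewrite eqmodE; apply/asboolP.
Qed.

Lemma frob_eq_repr s : frob_eq (repr (frob_word s)) s.
Proof. by apply/frob_wordP; rewrite /frob_word reprK. Qed.

Lemma frob_ind (Q : frob -> Prop) : (forall s, Q (frob_word s)) -> forall z, Q z.
Proof. by move=> h z; rewrite -[z]reprK; exact: h. Qed.

Definition scale_word (r : R) (s : seq (R * M)) := [seq (r * t.1, t.2) | t <- s].

Lemma frob_eq_scale r s t : frob_eq s t -> frob_eq (scale_word r s) (scale_word r t).
Proof.
elim=> {s t} [s|s t _ h|s t u _ h1 _ h2|s s' t t' _ h1 _ h2|s t|x|a b x|a x y|a b x].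
- exact: frob_eq_refl.
- exact: frob_eq_sym.
- exact: frob_eq_trans h2.
- by rewrite /scale_word !map_cat; exact: frob_eq_cat.
- by rewrite /scale_word !map_cat; exact: frob_eq_comm.
- by rewrite /= mulr0; exact: frob_eq_0l.
- by rewrite /= mulrDr; exact: frob_eq_Dl.
- exact: frob_eq_Dr.
- by rewrite /= mulrCA; exact: frob_eq_bal.
Qed.

Definition frob_zero : frob := frob_word [::].
Definition frob_add (z w : frob) : frob := frob_word (repr z ++ repr w).
Definition frob_scale (r : R) (z : frob) : frob := frob_word (scale_word r (repr z)).
Definition frob_opp (z : frob) : frob := frob_scale (-1) z.

Lemma frob_addE s t : frob_add (frob_word s) (frob_word t) = frob_word (s ++ t).
Proof. by apply/frob_wordP/frob_eq_cat; exact: frob_eq_repr. Qed.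

Lemma frob_scaleE r s : frob_scale r (frob_word s) = frob_word (scale_word r s).
Proof. by apply/frob_wordP/frob_eq_scale; exact: frob_eq_repr. Qed.

Lemma frob_addA : associative frob_add.
Proof.
elim/frob_ind=> s; elim/frob_ind=> t; elim/frob_ind=> u.
by rewrite !frob_addE catA.
Qed.

Lemma frob_addC : commutative frob_add.
Proof.
elim/frob_ind=> s; elim/frob_ind=> t; rewrite !frob_addE.
by apply/frob_wordP; exact: frob_eq_comm.
Qed.

Lemma frob_add0 : left_id frob_zero frob_add.
Proof. by elim/frob_ind=> s; rewrite frob_addE. Qed.

Lemma frob_scaleDl z (r r' : R) :
  frob_scale (r + r') z = frob_add (frob_scale r z) (frob_scale r' z).
Proof.
elim/frob_ind: z => s; elim: s => [|[a x] s IH].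
  by rewrite !frob_scaleE frob_addE.
have E q : frob_scale q (frob_word ((a, x) :: s)) =
    frob_add (frob_word [:: (q * a, x)]) (frob_scale q (frob_word s)).
  by rewrite !frob_scaleE frob_addE.
rewrite !{}E {}IH mulrDl.
have -> : frob_word [:: (r * a + r' * a, x)] =
    frob_add (frob_word [:: (r * a, x)]) (frob_word [:: (r' * a, x)]).
  by rewrite frob_addE; apply/frob_wordP; exact: frob_eq_Dl.
rewrite -!frob_addA; congr frob_add; rewrite !frob_addA; congr frob_add.
exact: frob_addC.
Qed.

Lemma frob_scale0 z : frob_scale 0 z = frob_zero.
Proof.
elim/frob_ind: z => s; rewrite frob_scaleE; apply/frob_wordP.
elim: s => [|[a x] s IH]; first exact: frob_eq_refl.
rewrite /= mul0r -cat1s -[X in frob_eq _ X]cat0s.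
by apply: frob_eq_cat IH; exact: frob_eq_0l.
Qed.

Lemma frob_scale1 : left_id 1 frob_scale.
Proof.
elim/frob_ind=> s; rewrite frob_scaleE; congr frob_word.
by elim: s => //= -[a x] s ->; rewrite mul1r.
Qed.

Lemma frob_scaleA (r r' : R) z :
  frob_scale r (frob_scale r' z) = frob_scale (r * r') z.
Proof.
elim/frob_ind: z => s; rewrite !frob_scaleE; congr frob_word.
by elim: s => //= -[a x] s ->; rewrite mulrA.
Qed.

Lemma frob_scaleDr : right_distributive frob_scale frob_add.
Proof.
move=> r; elim/frob_ind=> s; elim/frob_ind=> t.
by rewrite !(frob_addE, frob_scaleE) /scale_word map_cat.
Qed.

Lemma frob_addN : left_inverse frob_zero frob_opp frob_add.
Proof.
move=> z; rewrite -{2}[z]frob_scale1 /frob_opp -frob_scaleDl addNr.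
exact: frob_scale0.
Qed.

HB.instance Definition _ :=
  GRing.isZmodule.Build frob frob_addA frob_addC frob_add0 frob_addN.
HB.instance Definition _ :=
  GRing.Zmodule_isLmodule.Build R frob
    frob_scaleA frob_scale1 frob_scaleDr frob_scaleDl.

Definition frob_tensor (r : R) (x : M) : frob := frob_word [:: (r, x)].

End Frobenius.

Section FrobeniusUniversal.
Variables (p : nat) (R : comNzRingType) (M N : lmodType R) (g : M -> N).
Hypothesis gD : forall x y, g (x + y) = g x + g y.
Hypothesis gZ : forall r x, g (r *: x) = r ^+ p *: g x.

Lemma frob_univ :
  exists h : {linear frob p M -> N},
    (forall r x, h (frob_tensor p r x) = r *: g x) /\
    forall h' : {linear frob p M -> N},
      (forall r x, h' (frob_tensor p r x) = r *: g x) -> h' =1 h.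
Proof.
pose hw (s : seq (R * M)) := \sum_(t <- s) t.1 *: g t.2.
have hwE s t : frob_eq p s t -> hw s = hw t.
  elim=> {s t} [s|s t _ ->|s t u _ -> _ ->|s s' t t' _ h1 _ h2|s t|x|a b x|a x y|a r x] //.
  - by rewrite /hw !big_cat /=; congr (_ + _).
  - by rewrite /hw !big_cat /= addrC.
  - by rewrite /hw big_seq1 big_nil scale0r.
  - by rewrite /hw !big_cons !big_nil !addr0 scalerDl.
  - by rewrite /hw !big_cons !big_nil !addr0 /= gD scalerDr.
  - by rewrite /hw !big_seq1 /= gZ scalerA mulrC.
pose h (z : frob p M) := hw (repr z).
have hE s : h (frob_word p s) = hw s by apply: hwE; exact: frob_eq_repr.
have hlin : linear h.
  move=> r; elim/frob_ind=> s; elim/frob_ind=> t.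
  rewrite [r *: _]frob_scaleE [_ + _]frob_addE !hE /hw big_cat /=.
  rewrite big_map scaler_sumr; congr (_ + _).
  by apply: eq_bigr => u _; rewrite scalerA.
pose hL := GRing.isLinear.Build R (frob p M) N _ h hlin.
pose H : {linear frob p M -> N} := HB.pack h hL.
exists H; split=> [r x|h' h'E]; first by rewrite /= hE /hw big_seq1.
elim/frob_ind=> s; rewrite /= hE; elim: s => [|[a x] s IH].
  by rewrite /hw big_nil; exact: linear0.
rewrite /hw big_cons -/(hw s) -IH -h'E -linearD.
by congr (h' _); rewrite [RHS]frob_addE.
Qed.

End FrobeniusUniversal.

Section FrobeniusMap.
Variables (p : nat) (R : comNzRingType) (M N : lmodType R) (f : {linear M -> N}).

Definition map_word (s : seq (R * M)) : seq (R * N) := [seq (t.1, f t.2) | t <- s].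

(* F_R(f), mapping r (x) x to r (x) f x; see [frob_map_tensor]. *)
Definition frob_map (z : frob p M) : frob p N := frob_word p (map_word (repr z)).

Lemma frob_eq_map s t : frob_eq p s t -> frob_eq p (map_word s) (map_word t).
Proof.
elim=> {s t} [s|s t _ h|s t u _ h1 _ h2|s s' t t' _ h1 _ h2|s t|x|a b x|a x y|a b x].
- exact: frob_eq_refl.
- exact: frob_eq_sym.
- exact: frob_eq_trans h2.
- by rewrite /map_word !map_cat; exact: frob_eq_cat.
- by rewrite /map_word !map_cat; exact: frob_eq_comm.
- exact: frob_eq_0l.
- exact: frob_eq_Dl.
- by rewrite /= linearD; exact: frob_eq_Dr.
- by rewrite /= linearZ; exact: frob_eq_bal.
Qed.

Lemma frob_mapE s : frob_map (frob_word p s) = frob_word p (map_word s).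
Proof. by apply/frob_wordP/frob_eq_map; exact: frob_eq_repr. Qed.

Lemma frob_map_tensor r x :
  frob_map (frob_tensor p r x) = frob_tensor p r (f x).
Proof. exact: frob_mapE. Qed.

Lemma frob_map_is_linear : linear frob_map.
Proof.
move=> r; elim/frob_ind=> s; elim/frob_ind=> t.
rewrite [r *: _]frob_scaleE [_ + _]frob_addE !frob_mapE.
rewrite [r *: _]frob_scaleE [_ + _]frob_addE.
by rewrite /map_word /scale_word map_cat -!map_comp.
Qed.

HB.instance Definition _ :=
  GRing.isLinear.Build R (frob p M) (frob p N) _ frob_map frob_map_is_linear.

End FrobeniusMap.

Arguments frob_map p {R M N} f z.

Section FModules.
Variables (p : nat) (R : comNzRingType).

Fixpoint frob_iter (e : nat) (U : lmodType R) : lmodType R :=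
  if e is e'.+1 then frob p (frob_iter e' U) else U.

(* F_R^e(beta). *)
Fixpoint frob_iter_map (U : lmodType R) (beta : {linear U -> frob p U})
    (e : nat) : {linear frob_iter e U -> frob_iter e.+1 U} :=
  match e return {linear frob_iter e U -> frob_iter e.+1 U} with
  | 0 => beta
  | e'.+1 => frob_map p (frob_iter_map beta e')
  end.

(* M, with the maps phi, is the direct limit of the sequence (V, f) in the
   category of R-modules. *)
Definition is_direct_limit (V : nat -> lmodType R)
    (f : forall e, {linear V e -> V e.+1})
    (M : lmodType R) (phi : forall e, {linear V e -> M}) : Prop :=
  (forall e v, phi e.+1 (f e v) = phi e v) /\
  forall (N : lmodType R) (psi : forall e, {linear V e -> N}),
    (forall e v, psi e.+1 (f e v) = psi e v) ->
    exists h : {linear M -> N},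
      (forall e v, h (phi e v) = psi e v) /\
      forall h' : {linear M -> N},
        (forall e v, h' (phi e v) = psi e v) -> h' =1 h.

(* The last clause says that theta is the map induced on direct limits by the
   maps F^e(beta) from F^e(U) to F(F^e(U)), the maps frob_map (phi e) being those
   of F_R(M) as the direct limit of the F(F^e(U)). *)
Definition generating_morphism (M : lmodType R) (theta : {linear M -> frob p M})
    (U : lmodType R) (beta : {linear U -> frob p U}) : Prop :=
  injective beta /\
  exists phi : forall e, {linear frob_iter e U -> M},
    is_direct_limit (frob_iter_map beta) phi /\
    forall e u, theta (phi e u) = frob_map p (phi e) (frob_iter_map beta e u).

End FModules.

(* In {mpoly A[m + n]} the first m variables are the x_i and the last n
   variables are the y_j. *)
Section Bigraded.
Variables (A : comNzRingType) (m n : nat).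
Local Notation R := {mpoly A[m + n]}.

Definition mnm_bideg (u : 'X_{1.. m + n}) : int * int :=
  ((\sum_(i < m) u (lshift n i))%N%:Z, (\sum_(j < n) u (rshift m j))%N%:Z).

Definition mpoly_bihomog (d : int * int) (f : R) : Prop :=
  forall u, u \in msupp f -> mnm_bideg u = d.

(* M is the internal direct sum of the subgroups g d. *)
Definition is_bigrading (M : lmodType R) (g : int * int -> M -> Prop) : Prop :=
  [/\ forall d, g d 0 /\ (forall x y, g d x -> g d y -> g d (x - y)),
      forall d e r x, mpoly_bihomog d r -> g e x -> g (d + e) (r *: x),
      forall x, exists (s : seq (int * int)) (c : int * int -> M),
        (forall d, g d (c d)) /\ x = \sum_(d <- s) c d &
      forall (s : seq (int * int)) (c : int * int -> M),
        uniq s -> (forall d, g d (c d)) -> \sum_(d <- s) c d = 0 ->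
        forall d, d \in s -> c d = 0].

Variable p : nat.

(* The subgroup generated by the r (x) x with bideg r + p bideg x = d. *)
Inductive frob_bigrading (M : lmodType R) (g : int * int -> M -> Prop)
    (d : int * int) : frob p M -> Prop :=
| frob_bigrading0 : frob_bigrading g d 0
| frob_bigradingD z w :
    frob_bigrading g d z -> frob_bigrading g d w -> frob_bigrading g d (z + w)
| frob_bigrading_tensor d1 d2 r x :
    mpoly_bihomog d1 r -> g d2 x -> d = d1 + d2 *+ p ->
    frob_bigrading g d (frob_tensor p r x).

Definition preserves_bidegree (M : lmodType R) (g : int * int -> M -> Prop)
    (f : M -> frob p M) : Prop :=
  forall d x, g d x -> frob_bigrading g d (f x).

Definition bigraded_F_module (M : lmodType R) (gM : int * int -> M -> Prop)
    (theta : {linear M -> frob p M}) : Prop :=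
  [/\ bijective theta, is_bigrading gM & preserves_bidegree gM theta].

Definition bigraded_F_finite (M : lmodType R) (gM : int * int -> M -> Prop)
    (theta : {linear M -> frob p M}) : Prop :=
  bigraded_F_module gM theta /\
  exists (U : lmodType R) (gU : int * int -> U -> Prop)
         (beta : {linear U -> frob p U}),
    [/\ fin_gen U, is_bigrading gU, preserves_bidegree gU beta &
        generating_morphism theta beta].

Definition nonzero_piece (M : lmodType R) (g : int * int -> M -> Prop)
    (a b : int) : Prop :=
  exists x, g (a, b) x /\ x <> 0.

End Bigraded.

(* Main.v *)
Require Import Defs.
From mathcomp Require Import all_boot all_order all_algebra.
From mathcomp Require Import zify boolp mpoly.

Set Implicit Arguments.
Unset Strict Implicit.
Unset Printing Implicit Defensive.

Import Order.TTheory GRing.Theory Num.Theory.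
Local Open Scope ring_scope.

(* Iterating theta gives bigraded isomorphisms of M with F^e(M) for all e.  Put
   q = p ^ e.  As R is free over A[x^q, y^q] on the monomials X^w with exponents
   below q, the component M_d is the direct sum of the F_A^e(M_d') over the pairs
   (w, d') with d = bideg w + q d'.  Each coordinate of bideg w runs through
   [0, k(q - 1)], k = m or n, so for q large a nonzero M_d in one of the four
   quadrants yields a d' in a fixed finite box with F_A^e(M_d') nonzero.  As
   F_A(0) = 0, the pigeonhole principle produces one d' in the box with
   F_A^e(M_d') nonzero for all e, and this d' contributes to every component of
   the quadrant once q is large. *)

Lemma morph_add0 (V W : zmodType) (h : V -> W) : {morph h : x y / x + y} -> h 0 = 0.
Proof. by move=> hD; apply: (@addrI _ (h 0)); rewrite -hD !addr0. Qed.

Lemma morph_add_sum (V W : zmodType) (h : V -> W) (I : Type) (s : seq I)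
    (F : I -> V) :
  {morph h : x y / x + y} -> h (\sum_(i <- s) F i) = \sum_(i <- s) h (F i).
Proof. by move=> hD; apply: (big_morph h hD); apply: morph_add0. Qed.

(** * Tensor calculus in the Frobenius functor *)

Section FrobTensor.
Variables (q : nat) (R : comNzRingType) (M : lmodType R).
Local Notation tens := (@frob_tensor q R M).

Lemma frob_tensorDl (r s : R) x : tens (r + s) x = tens r x + tens s x.
Proof. by rewrite [RHS]frob_addE; apply/frob_wordP; apply: frob_eq_Dl. Qed.

Lemma frob_tensorDr r x y : tens r (x + y) = tens r x + tens r y.
Proof. by rewrite [RHS]frob_addE; apply/frob_wordP; apply: frob_eq_Dr. Qed.

Lemma frob_tensor_bal r s x : tens r (s *: x) = tens (s ^+ q * r) x.
Proof. by apply/frob_wordP; apply: frob_eq_bal. Qed.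

Lemma frob_tensorZ r s x : r *: tens s x = tens (r * s) x.
Proof. by rewrite [LHS]frob_scaleE. Qed.

Lemma frob_tensor1Z r x : tens 1 (r *: x) = r ^+ q *: tens 1 x.
Proof. by rewrite frob_tensor_bal frob_tensorZ. Qed.

Lemma frob_tensor0 r : tens r 0 = 0.
Proof. exact: (morph_add0 (frob_tensorDr r)). Qed.

Lemma frob_tensor_suml (I : Type) (s : seq I) (F : I -> R) x :
  tens (\sum_(i <- s) F i) x = \sum_(i <- s) tens (F i) x.
Proof.
by apply: (@morph_add_sum _ _ (tens^~ x)) => a b; exact: frob_tensorDl.
Qed.

Lemma frob_tensor_ind (Q : frob q M -> Prop) :
  Q 0 -> (forall z w, Q z -> Q w -> Q (z + w)) -> (forall r x, Q (tens r x)) ->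
  forall z, Q z.
Proof.
move=> Q0 QD Qt; elim/frob_ind; elim=> [|[r x] s IH]; first exact: Q0.
by rewrite -cat1s -frob_addE; apply: QD; [exact: Qt | exact: IH].
Qed.

(** Unlike in [frob_univ], the target is a bare abelian group: the maps built from it below are
    Frobenius-semilinear or merely additive. *)
Lemma frob_lift (Z : zmodType) (B : R -> M -> Z) :
  (forall x, {morph B^~ x : r s / r + s}) -> (forall r, {morph B r : x y / x + y}) ->
  (forall a r x, B a (r *: x) = B (r ^+ q * a) x) ->
  exists h : frob q M -> Z,
    {morph h : z w / z + w} /\ forall r x, h (tens r x) = B r x.
Proof.
move=> BDl BDr Bbal.
pose hw (s : seq (R * M)) := \sum_(t <- s) B t.1 t.2.
have hwE s t : frob_eq q s t -> hw s = hw t.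
  elim=> {s t} [s|s t _ ->|s t u _ -> _ ->|s s' t t' _ h1 _ h2|s t|x|a b x|a x y|a r x] //.
  - by rewrite /hw !big_cat /=; congr (_ + _).
  - by rewrite /hw !big_cat /= addrC.
  - by rewrite /hw big_seq1 big_nil; exact: (morph_add0 (BDl x)).
  - by rewrite /hw !big_cons !big_nil !addr0 /= BDl.
  - by rewrite /hw !big_cons !big_nil !addr0 /= BDr.
  - by rewrite /hw !big_seq1 /= Bbal.
have hE s : hw (repr (frob_word q s)) = hw s by apply: hwE; exact: frob_eq_repr.
exists (fun z => hw (repr z)); split=> [|r x]; last by rewrite hE /hw big_seq1.
elim/frob_ind=> s; elim/frob_ind=> t; rewrite [_ + _]frob_addE !hE /hw.
exact: big_cat.
Qed.

End FrobTensor.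

(** * Raising the Frobenius exponent in characteristic p *)

Section Iterate.
Variables (R : comNzRingType) (p : nat) (pR : p \in [pchar R]).

Lemma exprDn_pcharX e (x y : R) : (x + y) ^+ (p ^ e) = x ^+ (p ^ e) + y ^+ (p ^ e).
Proof.
by rewrite exprDn_pchar // pnatX pnatE ?pR ?(pcharf_prime pR).
Qed.

(** Once [frob p (frob q M)] is identified with [frob (p * q) M], this is the p-linear map sending z
    to 1 (x) z. *)
Lemma frob_raise q (M : lmodType R) :
  exists h : frob q M -> frob (p * q) M,
    [/\ {morph h : z w / z + w}, forall r z, h (r *: z) = r ^+ p *: h z &
        forall s x, h (frob_tensor q s x) = frob_tensor (p * q) (s ^+ p) x].
Proof.
have [|r|a r x|h [hD hE]] := @frob_lift q R M _ (fun s x => frob_tensor (p * q) (s ^+ p) x).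
- by move=> x r s; rewrite -frob_tensorDl -(exprDn_pcharX 1).
- exact: frob_tensorDr.
- by rewrite frob_tensor_bal exprMn -exprM mulnC.
exists h; split=> // r; elim/frob_tensor_ind=> [|z w IHz IHw|s x].
- by rewrite scaler0 (morph_add0 hD) scaler0.
- by rewrite scalerDr !hD IHz IHw scalerDr.
- by rewrite frob_tensorZ !hE frob_tensorZ exprMn.
Qed.

End Iterate.

(** * Bidegrees of polynomials and iteration of [theta] *)

Section Bidegree.
Variables (A : comNzRingType) (m n : nat).
Local Notation R := {mpoly A[m + n]}.
Implicit Types (d : int * int) (u v : 'X_{1.. m + n}).

Lemma mnm_bidegD u v : mnm_bideg (u + v) = mnm_bideg u + mnm_bideg v.
Proof.
by congr (_, _); rewrite /= -PoszD -big_split /=; congr Posz;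
  apply: eq_bigr => i _; rewrite mnmDE.
Qed.

Lemma mnm_bideg0 : mnm_bideg (0%MM : 'X_{1.. m + n}) = 0.
Proof. by congr (_, _); rewrite /= big1 // => i _; rewrite mnm0E. Qed.

Lemma mnm_bidegM u k : mnm_bideg (u *+ k) = mnm_bideg u *+ k.
Proof.
elim: k => [|k IH]; first by rewrite mulm0n mnm_bideg0.
by rewrite mulmS mnm_bidegD IH mulrS.
Qed.

Lemma bihomogC (a : A) : mpoly_bihomog (0 : int * int) (a%:MP : R).
Proof.
move=> u; rewrite msuppC; case: ifP => // _; rewrite inE => /eqP->.
exact: mnm_bideg0.
Qed.

Lemma bihomogX u : mpoly_bihomog (mnm_bideg u) ('X_[u] : R).
Proof. by move=> v; rewrite msuppX inE => /eqP->. Qed.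

Lemma bihomogM d e (r s : R) :
  mpoly_bihomog d r -> mpoly_bihomog e s -> mpoly_bihomog (d + e) (r * s).
Proof.
move=> hr hs u /msuppM_le /allpairsP [[v w] /= [/hr <- /hs <- ->]].
exact: mnm_bidegD.
Qed.

Lemma bihomogXn d (r : R) k : mpoly_bihomog d r -> mpoly_bihomog (d *+ k) (r ^+ k).
Proof.
move=> hr; elim: k => [|k IH]; first exact: bihomogC.
by rewrite exprS mulrS; apply: bihomogM.
Qed.

(** The exponent q is free so that iterates of [theta] land in a single tensor product
    [frob (p ^ e) M] instead of e nested ones. *)
Definition frob_structure (q : nat) (M : lmodType R) (g : int * int -> M -> Prop) : Prop :=
  exists (theta : {linear M -> frob q M}) (h : frob q M -> M),
    [/\ cancel theta h, cancel h theta & preserves_bidegree g theta].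

Lemma frob_structureM (p q : nat) (M : lmodType R) (g : int * int -> M -> Prop) :
  p \in [pchar R] ->
  frob_structure p g -> frob_structure q g -> frob_structure (p * q) g.
Proof.
move=> pR [th [k [thK kK thg]]] [thq [h [thqK hK thqg]]].
have hD : {morph h : z w / z + w}.
  by move=> z w; apply: (can_inj thqK); rewrite linearD !hK.
have hZ r z : h (r *: z) = r *: h z.
  by apply: (can_inj thqK); rewrite linearZ /= !hK.
have [psi [psiD psiZ psiE]] := @frob_raise _ _ pR q M.
(* [tau] is F_p([thq]) followed by the identification of F_p(F_q(M)) with F_pq(M); [rho] below is
   its inverse. *)
have [|r x|tau [tauE _]] := @frob_univ p R M _ (psi \o thq).
- by move=> x y; rewrite /= linearD psiD.
- by rewrite /= linearZ psiZ.
have [|r x|rho [rhoE _]] :=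
    @frob_univ (p * q) R M _ (fun x => frob_tensor p 1 (h (frob_tensor q 1 x))).
- by move=> x y; rewrite frob_tensorDr hD frob_tensorDr.
- by rewrite frob_tensor1Z hZ frob_tensor1Z -exprM mulnC.
have rho_psi z : rho (psi z) = frob_tensor p 1 (h z).
  elim/frob_tensor_ind: z => [|z w IHz IHw|s x].
  - by rewrite (morph_add0 psiD) (morph_add0 hD) frob_tensor0 linear0.
  - by rewrite psiD hD frob_tensorDr linearD IHz IHw.
  - by rewrite psiE rhoE -[s in RHS]mulr1 -frob_tensorZ hZ frob_tensor1Z frob_tensorZ.
have tauK : cancel tau rho.
  elim/frob_tensor_ind=> [|z w IHz IHw|r x]; first by rewrite !linear0.
    by rewrite !linearD IHz IHw.
  by rewrite tauE /= linearZ /= rho_psi thqK frob_tensorZ mulr1.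
have rhoK : cancel rho tau.
  elim/frob_tensor_ind=> [|z w IHz IHw|r x]; first by rewrite !linear0.
    by rewrite !linearD IHz IHw.
  by rewrite rhoE linearZ /= tauE /= hK psiE expr1n scale1r frob_tensorZ mulr1.
(* [psi] multiplies degrees by p, which is what the grading of [frob (p * q) M] requires of
   [tau]. *)
have psig d1 d2 r z : mpoly_bihomog d1 r -> frob_bigrading g d2 z ->
    frob_bigrading g (d1 + d2 *+ p) (r *: psi z).
  move=> hr; elim=> {z} [|z w _ IHz _ IHw|e1 e2 s x hs gx ->].
  - by rewrite (morph_add0 psiD) scaler0; apply: frob_bigrading0.
  - by rewrite psiD scalerDr; apply: frob_bigradingD.
  - rewrite psiE frob_tensorZ; apply: frob_bigrading_tensor gx _.
      exact: bihomogM hr (bihomogXn (k := p) hs).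
    by rewrite mulrnDl addrA -mulrnA mulnC.
have taug d z : frob_bigrading g d z -> frob_bigrading g d (tau z).
  elim=> {z} [|z w _ IHz _ IHw|e1 e2 s x hs gx ->].
  - by rewrite linear0; apply: frob_bigrading0.
  - by rewrite linearD; apply: frob_bigradingD.
  - by rewrite tauE; apply: psig; last apply: thqg.
exists (tau \o th), (k \o rho); split; first exact: can_comp tauK thK.
  exact: can_comp kK rhoK.
by move=> d x gx; apply/taug/thg.
Qed.

Lemma frob_structureX (p e : nat) (M : lmodType R) (g : int * int -> M -> Prop) :
  p \in [pchar R] -> frob_structure p g -> frob_structure (p ^ e.+1) g.
Proof.
move=> pR sp; elim: e => [|e IH]; first by rewrite expn1.
by rewrite expnS; apply: frob_structureM.
Qed.

End Bidegree.

(** * Projection onto one bigraded component *)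

Section Components.
Variables (A : comNzRingType) (m n : nat).
Local Notation R := {mpoly A[m + n]}.
Variables (M : lmodType R) (g : int * int -> M -> Prop).
Hypothesis gM : is_bigrading g.
Implicit Types (d e : int * int) (l : seq ((int * int) * M)).

(** The list may repeat a degree, so decompositions of two elements can simply be concatenated to
    decompose their sum. *)
Lemma bigrading_decomp x :
  exists l, {in l, forall t, g t.1 t.2} /\ x = \sum_(t <- l) t.2.
Proof.
case: gM => _ _ /(_ x) [s [c [gc ->]]] _.
exists [seq (e, c e) | e <- s]; split; last by rewrite big_map.
by move=> _ /mapP[e _ ->]; exact: gc.
Qed.

Lemma bigrading_sum (I : eqType) (s : seq I) (Q : pred I) (F : I -> M) d :
  (forall i, i \in s -> Q i -> g d (F i)) -> g d (\sum_(i <- s | Q i) F i).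
Proof.
case: gM => /(_ d) [g0 gB] _ _ _ h; rewrite big_seq_cond.
apply: (big_ind (g d)) => // [x y gx gy|i /andP[]]; last exact: h.
by rewrite -[y]opprK -[- y]sub0r; apply: (gB) => //; apply: gB.
Qed.

Lemma bigrading_sum0 l d : {in l, forall t, g t.1 t.2} ->
  \sum_(t <- l) t.2 = 0 -> \sum_(t <- l | t.1 == d) t.2 = 0.
Proof.
(* Terms of equal degree are collected first, because independence of the components is stated for
   distinct degrees. *)
move=> gl l0; pose c e := \sum_(t <- l | t.1 == e) t.2.
pose s := undup (map fst l).
have mem_s t : t \in l -> t.1 \in s by move=> tl; rewrite mem_undup map_f.
have gc e : g e (c e) by apply: bigrading_sum => t tl /eqP <-; exact: gl.
have sc0 : \sum_(e <- s) c e = 0.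
  rewrite (exchange_big_dep predT) //= -[RHS]l0.
  rewrite [LHS]big_seq [RHS]big_seq; apply: eq_bigr => t tl.
  rewrite big_mkcond (bigD1_seq t.1) ?mem_s ?undup_uniq //= eqxx.
  by rewrite big1 ?addr0 // => e; rewrite eq_sym => /negbTE->.
have [ds|ds] := boolP (d \in s).
  by case: gM => _ _ _ /(_ s c (undup_uniq _) gc sc0); apply.
rewrite big_seq_cond big1 // => t /andP[/mem_s ts /eqP td].
by rewrite -td ts in ds.
Qed.

Lemma bigrading_sum_eq l1 l2 d :
  {in l1, forall t, g t.1 t.2} -> {in l2, forall t, g t.1 t.2} ->
  \sum_(t <- l1) t.2 = \sum_(t <- l2) t.2 ->
  \sum_(t <- l1 | t.1 == d) t.2 = \sum_(t <- l2 | t.1 == d) t.2.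
Proof.
move=> gl1 gl2 E; pose l := l1 ++ [seq (t.1, - t.2) | t <- l2].
have /(_ d) : forall d, \sum_(t <- l | t.1 == d) t.2 = 0.
  move=> e; apply: bigrading_sum0 => [t|].
    rewrite mem_cat => /orP[/gl1 //|/mapP[u /gl2 gu ->] /=].
    by case: gM => /(_ u.1) [g0 gB] _ _ _; rewrite -sub0r; apply: gB.
  by rewrite big_cat big_map /= sumrN E subrr.
by rewrite big_cat big_map /= sumrN => /subr0_eq.
Qed.

(** P keeps the terms of degree d in a chosen decomposition; [bigrading_sum_eq] makes the result
    independent of the choice. It commutes with A because A has degree (0, 0). *)
Lemma bigrading_component d : exists P : M -> M,
  [/\ {morph P : x y / x + y}, forall x, g d x -> P x = x,
      forall e x, e <> d -> g e x -> P x = 0 &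
      forall (a : A) x, P (a%:MP *: x) = a%:MP *: P x].
Proof.
pose l x := projT1 (cid (bigrading_decomp x)).
have lP x : {in l x, forall t, g t.1 t.2} /\ x = \sum_(t <- l x) t.2.
  exact: projT2 (cid (bigrading_decomp x)).
pose P x := \sum_(t <- l x | t.1 == d) t.2.
have PE s x : {in s, forall t, g t.1 t.2} -> x = \sum_(t <- s) t.2 ->
    P x = \sum_(t <- s | t.1 == d) t.2.
  by have [gl xl] := lP x => gs xs; apply: bigrading_sum_eq; rewrite -?xl.
have Pg e x : g e x -> P x = if e == d then x else 0.
  move=> gx; rewrite (PE [:: (e, x)]) ?big_seq1 ?big_cons ?big_nil /= ?addr0 //.
  by move=> t; rewrite inE => /eqP->.
exists P; split=> [x y|x /Pg|e x /eqP /negbTE ed /Pg|a x].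
- have [gx xE] := lP x; have [gy yE] := lP y.
  rewrite (PE (l x ++ l y)) ?big_cat -?xE -?yE //.
  by move=> t; rewrite mem_cat => /orP[/gx|/gy].
- by rewrite eqxx.
- by rewrite ed.
- have [gx xE] := lP x; rewrite (PE [seq (t.1, a%:MP *: t.2) | t <- l x]).
  + by rewrite big_map /= scaler_sumr.
  + move=> _ /mapP[t /gx gt ->] /=; case: gM => _ gZ _ _.
    by rewrite -[t.1]add0r; apply: gZ => //; apply: bihomogC.
  + by rewrite big_map /= -scaler_sumr -xE.
Qed.

End Components.

(** * Additive maps prescribed on monomials *)

Section MonomialLift.
Variables (A : comNzRingType) (k q : nat).
Local Notation R := {mpoly A[k]}.

Lemma mpoly_lift (Z : zmodType) (F : 'X_{1..k} -> A -> Z) :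
  (forall u, {morph F u : a b / a + b}) ->
  exists B : R -> Z,
    {morph B : r s / r + s} /\ forall u a, B (a *: 'X_[u]) = F u a.
Proof.
move=> FD; pose B (r : R) := \sum_(u <- msupp r) F u r@_u.
(* Any duplicate-free list containing the support gives the same sum, so two polynomials can be
   treated over a common list. *)
have BE s r : uniq s -> {subset msupp r <= s} -> B r = \sum_(u <- s) F u r@_u.
  move=> us rs; rewrite (bigID (mem (msupp r))) /= [X in _ + X]big1 ?addr0.
    rewrite -big_filter; apply: perm_big; apply: uniq_perm => [||u].
    - exact: msupp_uniq.
    - exact: filter_uniq.
    - rewrite mem_filter /=; have [ur|//] := boolP (u \in msupp r).
      by rewrite rs.
  by move=> u /memN_msupp_eq0 ->; exact: (morph_add0 (FD u)).
exists B; split=> [r s|u a].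
  pose l := undup (msupp r ++ msupp s).
  rewrite !(BE l) ?undup_uniq // => [|u us|u us|u us].
  - by rewrite -big_split; apply: eq_bigr => u _; rewrite mcoeffD FD.
  - by rewrite mem_undup mem_cat us orbT.
  - by rewrite mem_undup mem_cat us.
  - by rewrite mem_undup; apply: msuppD_le.
rewrite (BE [:: u]) ?big_seq1 ?mcoeffZ ?mcoeffX ?eqxx ?mulr1 //.
by move=> v /msuppZ_le; rewrite msuppX.
Qed.

Lemma mpoly_monomial_ind (Q : R -> Prop) :
  Q 0 -> (forall r s, Q r -> Q s -> Q (r + s)) -> (forall a u, Q (a *: 'X_[u])) ->
  forall r, Q r.
Proof.
move=> Q0 QD QX; elim/mpolyind => [|c u r _ _ Qr]; first exact: Q0.
by apply: QD; [exact: QX | exact: Qr].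
Qed.

Hypothesis qD : forall r s : R, (r + s) ^+ q = r ^+ q + s ^+ q.

(** Both sides of the balancing identity are additive in each scalar, by [qD] for the one raised to
    the power q, so monomial scalars suffice. *)
Lemma frob_mpoly_lift (M : lmodType R) (Z : zmodType) (F : 'X_{1..k} -> A -> M -> Z) :
  (forall u x, {morph (F u)^~ x : a b / a + b}) ->
  (forall u a, {morph F u a : x y / x + y}) ->
  (forall u a b v x,
     F u a ((b *: 'X_[v]) *: x) = F (u + v *+ q)%MM (b ^+ q * a) x) ->
  exists h : frob q M -> Z,
    {morph h : z w / z + w} /\
    forall u a x, h (frob_tensor q (a *: 'X_[u]) x) = F u a x.
Proof.
move=> FDl FDr Fbal.
have BP x : exists B : R -> Z, {morph B : r s / r + s} /\
    forall u a, B (a *: 'X_[u]) = F u a x.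
  by apply: (mpoly_lift (F := fun u a => F u a x)).
pose B r x := projT1 (cid (BP x)) r.
have BD x : {morph B^~ x : r s / r + s} by case: (projT2 (cid (BP x))).
have BE u a x : B (a *: 'X_[u]) x = F u a x.
  by case: (projT2 (cid (BP x))) => _; apply.
have [||a r x|h [hD hE]] := @frob_lift q R M Z B.
- exact: BD.
- elim/mpoly_monomial_ind=> [|r s IHr IHs|a u] x y.
  + by rewrite !(morph_add0 (BD _)) addr0.
  + by rewrite !BD IHr IHs addrACA.
  + by rewrite !BE FDr.
- elim/mpoly_monomial_ind: a x => [|a b IHa IHb|a u] x.
  + by rewrite mulr0 !(morph_add0 (BD _)).
  + by rewrite mulrDr !BD IHa IHb.
  elim/mpoly_monomial_ind: r => [|r s IHr IHs|b v].
  + have q0 : (0 : R) ^+ q = 0 by apply: (morph_add0 qD).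
    by rewrite q0 mul0r scale0r BE (morph_add0 (FDr _ _)) (morph_add0 (BD _)).
  + by rewrite scalerDl qD mulrDl BD -IHr -IHs !BE FDr.
  + rewrite BE Fbal -BE; congr (B _ x).
    rewrite exprZn mpolyXn -scalerAl -scalerAr scalerA -mpolyXD.
    by rewrite addmC.
by exists h; split=> // u a x; rewrite hE BE.
Qed.

End MonomialLift.

(** * Division with remainder of exponent vectors *)

Definition mnm_div k q (u : 'X_{1..k}) : 'X_{1..k} := [multinom (u i %/ q)%N | i < k].
Definition mnm_mod k q (u : 'X_{1..k}) : 'X_{1..k} := [multinom (u i %% q)%N | i < k].

Lemma mnm_divn_eq k q (u : 'X_{1..k}) : u = (mnm_mod q u + mnm_div q u *+ q)%MM.
Proof. by apply/mnmP=> i; rewrite mnmDE mulmnE !mnmE addnC -divn_eq. Qed.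

Lemma mnm_divDMn k q (u v : 'X_{1..k}) :
  (0 < q)%N -> mnm_div q (u + v *+ q)%MM = (mnm_div q u + v)%MM.
Proof.
by move=> q0; apply/mnmP=> i; rewrite !(mnmE, mulmnE) addnC divnMDl // addnC.
Qed.

Lemma mnm_modDMn k q (u v : 'X_{1..k}) : mnm_mod q (u + v *+ q)%MM = mnm_mod q u.
Proof. by apply/mnmP=> i; rewrite !(mnmE, mulmnE) addnC modnMDl. Qed.

Lemma mnm_div_small k q (u : 'X_{1..k}) :
  (forall i, (u i < q)%N) -> mnm_div q u = 0%MM.
Proof. by move=> uq; apply/mnmP=> i; rewrite !mnmE divn_small. Qed.

Lemma mnm_mod_small k q (u : 'X_{1..k}) :
  (forall i, (u i < q)%N) -> mnm_mod q u = u.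
Proof. by move=> uq; apply/mnmP=> i; rewrite !mnmE modn_small. Qed.

(** * Nonvanishing of components of M and of their Frobenius twists *)

Section Pieces.
Variables (A : comNzRingType) (m n : nat).
Local Notation R := {mpoly A[m + n]}.
Variables (M : lmodType R) (g : int * int -> M -> Prop).
Hypothesis gM : is_bigrading g.
Implicit Types (d e : int * int) (u v w : 'X_{1.. m + n}).

(* Equivalently, F_A^e does not kill the component of degree d, where q = p ^ e. *)
Definition frob_nonzero q d := exists x, g d x /\ frob_tensor q 1 x <> 0.

(** The additive map of [frob_raise] sends 1 (x) x to 1 (x) x, so a tensor that vanishes at exponent
    q still vanishes at p q. *)
Lemma frob_nonzeroM p q d : p \in [pchar R] ->
  frob_nonzero (p * q) d -> frob_nonzero q d.
Proof.
move=> pR [x [gx nz]]; exists x; split=> // x0; apply: nz.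
have [h [hD _ hE]] := frob_raise pR q M.
by rewrite -[1 : R](expr1n _ p) -hE x0 (morph_add0 hD).
Qed.

(** Some homogeneous tensor in the image of a nonzero element is nonzero, hence so is X^u (x) x for
    a monomial X^u of its left factor. With u = w + q v this tensor is X^w (1 (x) X^v x), so X^v x
    is the required element. *)
Lemma nonzero_piece_descent q d : (0 < q)%N -> frob_structure q g ->
  nonzero_piece g d.1 d.2 ->
  exists w d', [/\ forall i, (w i < q)%N, d = mnm_bideg w + d' *+ q & frob_nonzero q d'].
Proof.
move=> q0 [th [h [thK _ thg]]] [x [/thg gx x0]].
have {x0}: th x <> 0 by move=> E; apply: x0; apply: (can_inj thK); rewrite E linear0.
rewrite -surjective_pairing in gx; move: gx.
elim=> {x} [|z w _ IHz _ IHw|d1 d2 r x hr gx dE] // zw0.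
  have [z0|/IHz //] := EM (z = 0).
  by apply: IHw => w0; apply: zw0; rewrite z0 w0 addr0.
have [u [ur ux0]] : exists u, u \in msupp r /\ frob_tensor q 'X_[u] x <> 0.
  apply: contrapT => none; apply: zw0.
  rewrite [r]mpolyE frob_tensor_suml big_seq big1 // => u ur.
  rewrite -mul_mpolyC -frob_tensorZ.
  have [->|nz] := EM (frob_tensor q 'X_[u] x = 0); first by rewrite scaler0.
  by case: none; exists u.
exists (mnm_mod q u), (mnm_bideg (mnm_div q u) + d2); split.
- by move=> i; rewrite mnmE ltn_mod.
- rewrite dE -(hr u ur) [in LHS](mnm_divn_eq q u) mnm_bidegD mnm_bidegM.
  by rewrite mulrnDl addrA.
exists ('X_[mnm_div q u] *: x); split.
  by case: gM => _ gZ _ _; apply: gZ => //; apply: bihomogX.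
move=> E; apply: ux0; rewrite [u in 'X_[u]](mnm_divn_eq q u) mpolyXD mulrC -mpolyXn.
by rewrite -frob_tensor_bal -[X in frob_tensor q X _]mulr1 -frob_tensorZ E scaler0.
Qed.

(** The natural witness is the preimage of X^w (x) x. Degree preservation is given for [theta] and
    not for its inverse, so the preimage is split into components, and an additive map [K] shows
    that the component of degree e is nonzero. *)
Lemma nonzero_piece_ascent q w d : (0 < q)%N ->
  (forall r s : R, (r + s) ^+ q = r ^+ q + s ^+ q) ->
  frob_structure q g -> (forall i, (w i < q)%N) -> frob_nonzero q d ->
  let e := mnm_bideg w + d *+ q in nonzero_piece g e.1 e.2.
Proof.
move=> q0 qD [th [h [_ hK thg]]] wq [x [gx nz]] e; apply: contrapT => e0.
have ge y : g e y -> y = 0.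
  move=> gy; apply: contrapT => y0; apply: e0; exists y.
  by rewrite -surjective_pairing.
have [P [PD Pd Pe PZ]] := bigrading_component gM d.
(* K reads off the coefficient of X^w over A[x^q, y^q] in the left factor and
   projects to the component of degree d; it kills the degrees other than e. *)
pose F u (a : A) y := if mnm_mod q u == w
  then frob_tensor q a%:MP (P ('X_[mnm_div q u] *: y)) else 0.
have [u y a b|u a y z|u a b v y|K [KD KE]] := @frob_mpoly_lift A (m + n) q qD M _ F.
- rewrite /F; case: ifP => _; last by rewrite addr0.
  by rewrite mpolyCD frob_tensorDl.
- rewrite /F; case: ifP => _; last by rewrite addr0.
  by rewrite scalerDr PD frob_tensorDr.
- rewrite /F mnm_modDMn mnm_divDMn //; case: ifP => // _.
  rewrite scalerA -scalerAr -mpolyXD -mul_mpolyC -scalerA PZ frob_tensor_bal.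
  by rewrite mpolyCM rmorphXn.
have K0 c z : c <> e -> frob_bigrading g c z -> K z = 0.
  move=> ce; elim=> {z} [|y z _ IHy _ IHz|d1 d2 r y hr gy cE].
  - exact: (morph_add0 KD).
  - by rewrite KD IHy IHz addr0.
  rewrite [r]mpolyE frob_tensor_suml (morph_add_sum _ _ KD) big_seq big1 // => u ur.
  (* When u has remainder w, the degree of X^(u div q) y equals d only if c = e; otherwise the
     projection kills it. *)
  rewrite KE /F; case: eqP => // uw; rewrite (Pe (mnm_bideg (mnm_div q u) + d2)).
  - exact: frob_tensor0.
  - move=> dE; apply: ce; rewrite cE /e -(hr u ur) [in LHS](mnm_divn_eq q u).
    by rewrite mnm_bidegD mnm_bidegM uw -dE mulrnDl addrA.
  - by case: gM => _ gZ _ _; apply: gZ => //; apply: bihomogX.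
(* As w has quotient 0 and remainder w, K sends X^w (x) x to 1 (x) x. *)
apply: nz; have := KE w 1 x.
rewrite /F mnm_mod_small // eqxx mnm_div_small // mpolyX0 !scale1r Pd // => <-.
have [l [gl hl]] := bigrading_decomp gM (h (frob_tensor q 'X_[w] x)).
rewrite -(hK (frob_tensor q 'X_[w] x)) hl linear_sum (morph_add_sum _ _ KD).
rewrite big_seq big1 // => t /gl; have [te|te] := EM (t.1 = e).
  by rewrite te => /ge ->; rewrite linear0 (morph_add0 KD).
by move=> gt; apply: K0 te _; apply: thg.
Qed.

End Pieces.

(** * Arithmetic of half-lines, boxes and digit sums *)

Definition half_line (s : bool) (k : nat) (a : int) : bool :=
  if s then 0 <= a else a <= - k%:Z.

(** For k > 0, a on the half-line and q > |a| + k, these are exactly the a' with a - a' q in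
    [0, k (q - 1)], the range of a coordinate of bideg w. They do not depend on a or q. *)
Definition core (s : bool) (k : nat) (a : int) : bool :=
  if s then - k%:Z < a <= 0 else - k%:Z <= a < 0.

(** Indexing by an ordinal allows a maximum to be taken over the box. *)
Lemma core_ord s k a : core s k a -> exists i : 'I_k.+1, a = - (i : nat)%:Z.
Proof.
move=> ka; have ak : (`|a|%N < k.+1)%N by case: s ka => /=; lia.
by exists (Ordinal ak); case: s ka => /=; lia.
Qed.

Lemma core_half_line s k q (a a' t : int) :
  (0 < k)%N -> half_line s k a -> (`|a|%N + k < q)%N ->
  0 <= t <= (k * q.-1)%N%:Z -> a = t + a' * q%:Z -> core s k a'.
Proof.
move=> k0 ha hq /andP[t0 tk] aE.
have {tk} : t <= k%:Z * q%:Z - k%:Z by nia.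
by case: s ha => /= ha tk; apply/andP; split; nia.
Qed.

Lemma half_line_core s k q (a a' : int) :
  half_line s k a -> (`|a|%N + k < q)%N -> core s k a' ->
  exists2 t : nat, (t <= k * q.-1)%N & a = t%:Z + a' * q%:Z.
Proof.
move=> ha hq ha'; have t0 : 0 <= a - a' * q%:Z.
  by case: s ha ha' => /=; nia.
exists `|(a - a' * q%:Z)%R|%N; last by lia.
suff : a - a' * q%:Z <= (k * q.-1)%N%:Z by lia.
by case: s ha ha' => /=; nia.
Qed.

(** Greedy choice: the last digit takes as much of t as it can. After the case split [q] denotes the
    largest digit, one less than the base. *)
Lemma sum_digits k q t : (0 < q)%N -> (t <= k * q.-1)%N ->
  exists f : nat -> nat, (forall i, (f i < q)%N) /\ (\sum_(i < k) f i)%N = t.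
Proof.
case: q => // q _; rewrite /=; elim: k t => [|k IH] t ht.
  by exists (fun=> 0%N); rewrite big_ord0; split=> //; lia.
have [|f [fq ft]] := IH (t - minn t q)%N; first by rewrite mulSn in ht; lia.
exists (fun i => if i == k then minn t q else f i); split=> [i|].
  by case: ifP => // _; lia.
rewrite big_ord_recr /= eqxx -[RHS](@subnK (minn t q)) ?geq_minl // -ft.
by congr addn; apply: eq_bigr => i _; rewrite ltn_eqF.
Qed.

Lemma fst_mulrn (d : int * int) q : (d *+ q).1 = d.1 * q%:Z.
Proof. by rewrite (raddfMn fst) -mulr_natr natz. Qed.

Lemma snd_mulrn (d : int * int) q : (d *+ q).2 = d.2 * q%:Z.
Proof. by rewrite (raddfMn snd) -mulr_natr natz. Qed.

Section Bidegrees.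
Variables (m n q : nat).

Lemma mnm_bideg_le (w : 'X_{1..m + n}) : (forall i, (w i < q)%N) ->
  0 <= (mnm_bideg w).1 <= (m * q.-1)%N%:Z /\ 0 <= (mnm_bideg w).2 <= (n * q.-1)%N%:Z.
Proof.
move=> wq; have sum_le k (F : 'I_k -> nat) :
    (forall i, (F i < q)%N) -> (\sum_(i < k) F i <= k * q.-1)%N.
  move=> Fq; rewrite -[X in (_ <= X * _)%N]card_ord -sum_nat_const.
  by apply: leq_sum => i _; have := Fq i; lia.
by rewrite /= !lez_nat; split; apply: sum_le.
Qed.

Lemma mnm_bideg_onto (s t : nat) : (0 < q)%N -> (s <= m * q.-1)%N -> (t <= n * q.-1)%N ->
  exists w : 'X_{1..m + n}, (forall i, (w i < q)%N) /\ mnm_bideg w = (s%:Z, t%:Z).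
Proof.
move=> q0 /(sum_digits q0)[f [fq <-]] /(sum_digits q0)[h [hq <-]].
exists [multinom match split i with inl j => f j | inr j => h j end | i < m + n].
split=> [i|]; first by rewrite mnmE; case: split.
congr (_%:Z, _%:Z); apply: eq_bigr => i _; rewrite mnmE.
  by rewrite (unsplitK (inl i)).
by rewrite (unsplitK (inr i)).
Qed.

End Bidegrees.

(** * Pigeonhole argument and rigidity on each quadrant *)

Section Rigidity.
Variables (A : comNzRingType) (m n p : nat).
Local Notation R := {mpoly A[m + n]}.
Variables (M : lmodType R) (g : int * int -> M -> Prop).
Hypotheses (pR : p \in [pchar R]) (gM : is_bigrading g) (sM : frob_structure p g).
Hypotheses (m0 : (0 < m)%N) (n0 : (0 < n)%N).

Let p_gt1 : (1 < p)%N. Proof. exact: prime_gt1 (pcharf_prime pR). Qed.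

Lemma frob_nonzero_le e e' d : (e <= e')%N ->
  frob_nonzero g (p ^ e') d -> frob_nonzero g (p ^ e) d.
Proof.
move/subnK <-; elim: (e' - e)%N => [|j IH] //.
by rewrite addSn expnS => /(frob_nonzeroM pR).
Qed.

Lemma nonzero_piece_core s1 s2 (a b : int) :
  half_line s1 m a -> half_line s2 n b -> nonzero_piece g a b ->
  exists d, [/\ core s1 m d.1, core s2 n d.2 & forall e, frob_nonzero g (p ^ e) d].
Proof.
move=> ha hb nz; apply: contrapT => none.
(* If no degree of the box survives all exponents, each one has an exponent [E d] at which it
   dies. *)
have /choice[E EP] d : exists e, core s1 m d.1 -> core s2 n d.2 ->
    ~ frob_nonzero g (p ^ e) d.
  apply: contrapT => ne; apply: none; exists d.
  have h e : ~ (core s1 m d.1 -> core s2 n d.2 -> ~ frob_nonzero g (p ^ e) d).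
    by move=> he; apply: ne; exists e.
  split=> [||e].
  - by apply: contrapT => c; apply: (h 0%N).
  - by apply: contrapT => c; apply: (h 0%N).
  - by apply: contrapT => c; apply: (h e).
pose bound := (\max_(i < m.+1) \max_(j < n.+1) E (- (i : nat)%:Z, - (j : nat)%:Z)%R)%N.
(* The term [bound] puts e above every [E d] of the box; the others make q exceed |a| + m and |b| +
   n. The exponent is e + 1 to match [frob_structureX]. *)
pose e := (bound + `|a| + `|b| + m + n)%N; pose q := (p ^ e.+1)%N.
have e_lt_q : (e < q)%N by rewrite (leq_trans (ltnSn e)) // ltnW // ltn_expl.
have q0 : (0 < q)%N by apply: leq_ltn_trans e_lt_q.
have [w [d [wq dE nzd]]] := @nonzero_piece_descent _ _ _ _ _ gM q (a, b) q0
  (frob_structureX e pR sM) nz.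
have [w1 w2] := mnm_bideg_le wq.
have c1 : core s1 m d.1.
  apply: (core_half_line m0 ha _ w1); first by rewrite /e in e_lt_q; lia.
  by rewrite -fst_mulrn; case: (dE).
have c2 : core s2 n d.2.
  apply: (core_half_line n0 hb _ w2); first by rewrite /e in e_lt_q; lia.
  by rewrite -snd_mulrn; case: (dE).
apply: (EP d c1 c2); apply: frob_nonzero_le nzd.
have [[i di] [j dj]] := (core_ord c1, core_ord c2).
have dij : d = (- (i : nat)%:Z, - (j : nat)%:Z) by rewrite -di -dj -surjective_pairing.
have : (E d <= bound)%N.
  rewrite dij; apply: leq_trans (leq_bigmax i).
  exact: (leq_bigmax (F := fun j : 'I_n.+1 => E (- (i : nat)%:Z, - (j : nat)%:Z)) j).
by rewrite /e; lia.
Qed.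

(** The degree d found from (a1, b1) lies in a box common to the whole quadrant, so for large q any
    (a, b) there is bideg w + q d for some w with entries below q, and the ascent applies. *)
Lemma nonzero_piece_quadrant s1 s2 (a1 b1 a b : int) :
  half_line s1 m a1 -> half_line s2 n b1 -> nonzero_piece g a1 b1 ->
  half_line s1 m a -> half_line s2 n b -> nonzero_piece g a b.
Proof.
move=> ha1 hb1 /(nonzero_piece_core ha1 hb1)[d [c1 c2 nzd]] ha hb.
pose e := (`|a| + `|b| + m + n)%N; pose q := (p ^ e.+1)%N.
have e_lt_q : (e < q)%N by rewrite (leq_trans (ltnSn e)) // ltnW // ltn_expl.
have q0 : (0 < q)%N by apply: leq_ltn_trans e_lt_q.
have [|s hs aE] := half_line_core (q := q) ha _ c1; first by rewrite /e in e_lt_q; lia.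
have [|t ht bE] := half_line_core (q := q) hb _ c2; first by rewrite /e in e_lt_q; lia.
have [w [wq wE]] := mnm_bideg_onto q0 hs ht.
have := nonzero_piece_ascent gM q0 (exprDn_pcharX pR e.+1) (frob_structureX e pR sM)
  wq (nzd e.+1).
by rewrite -/q wE /= fst_mulrn snd_mulrn -aE -bE.
Qed.

End Rigidity.

Theorem theoremB (p : nat) (k : fieldType) (A : comNzRingType)
    (iota : {rmorphism k -> A}) (m n : nat)
    (M : lmodType {mpoly A[m + n]}) (g : int * int -> M -> Prop)
    (theta : {linear M -> frob p M}) :
  p \in [pchar k] -> regular_ring A -> (1 <= m)%N -> (1 <= n)%N ->
  bigraded_F_finite g theta ->
  [/\ [<-> forall a b : int, 0 <= a -> 0 <= b -> nonzero_piece g a b;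
           exists a0 b0 : int, [/\ 0 <= a0, 0 <= b0 &
             forall a b : int, a0 <= a -> b0 <= b -> nonzero_piece g a b];
           exists a1 b1 : int, [/\ 0 <= a1, 0 <= b1 & nonzero_piece g a1 b1]],
      [<-> forall a b : int, a <= - m%:Z -> 0 <= b -> nonzero_piece g a b;
           exists a0 b0 : int, [/\ a0 <= - m%:Z, 0 <= b0 &
             forall a b : int, a <= a0 -> b0 <= b -> nonzero_piece g a b];
           exists a1 b1 : int, [/\ a1 <= - m%:Z, 0 <= b1 & nonzero_piece g a1 b1]],
      [<-> forall a b : int, a <= - m%:Z -> b <= - n%:Z -> nonzero_piece g a b;
           exists a0 b0 : int, [/\ a0 <= - m%:Z, b0 <= - n%:Z &
             forall a b : int, a <= a0 -> b <= b0 -> nonzero_piece g a b];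
           exists a1 b1 : int,
             [/\ a1 <= - m%:Z, b1 <= - n%:Z & nonzero_piece g a1 b1]] &
      [<-> forall a b : int, 0 <= a -> b <= - n%:Z -> nonzero_piece g a b;
           exists a0 b0 : int, [/\ 0 <= a0, b0 <= - n%:Z &
             forall a b : int, a0 <= a -> b <= b0 -> nonzero_piece g a b];
           exists a1 b1 : int,
             [/\ 0 <= a1, b1 <= - n%:Z & nonzero_piece g a1 b1]]].
Proof.
move=> pk _ m0 n0 [[[h thK hK] gM thg] _].
have pR : p \in [pchar {mpoly A[m + n]}].
  exact: (rmorph_pchar (@mpolyC (m + n) A) (rmorph_pchar iota pk)).
have sM : frob_structure p g by exists theta, h.
(* The two booleans select the quadrant, and Q gives (c) => (a). For (a) => (b) the corner of the
   quadrant serves as (a0, b0), and for (b) => (c) the point (a0, b0) itself. *)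
have Q s1 s2 := @nonzero_piece_quadrant A m n p M g pR gM sM m0 n0 s1 s2.
split.
- tfae=> [na|[a [b [ha hb nab]]]|[a [b [ha hb nab]]] c d].
  + by exists 0, 0.
  + by exists a, b; split; [..|apply: nab].
  + exact: (Q true true a b).
- tfae=> [na|[a [b [ha hb nab]]]|[a [b [ha hb nab]]] c d].
  + by exists (- m%:Z), 0.
  + by exists a, b; split; [..|apply: nab].
  + exact: (Q false true a b).
- tfae=> [na|[a [b [ha hb nab]]]|[a [b [ha hb nab]]] c d].
  + by exists (- m%:Z), (- n%:Z).
  + by exists a, b; split; [..|apply: nab].
  + exact: (Q false false a b).
- tfae=> [na|[a [b [ha hb nab]]]|[a [b [ha hb nab]]] c d].
  + by exists 0, (- n%:Z).
  + by exists a, b; split; [..|apply: nab].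
  + exact: (Q true false a b).
Qed.
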